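(* Let ${}^{*}X$ be a functional extension of a set $X$, endowed with the $S$-topology. Then: (1) the principle Ind holds in ${}^{*}X$ if and only if ${}^{*}X$ is Hausdorff; (2) the principle Poss holds in ${}^{*}X$ if and only if ${}^{*}X$ is quasi-compact; hence (3) the principles Ind and Poss hold simultaneously in ${}^{*}X$ if and only if ${}^{*}X$ is compact.
   Context: Convention: $X$ is a set with two distinct distinguished elements $0,1\in X$; characteristic functions take values in $\{0,1\}$, and so are regarded as functions into $X$ (or into a superset of $X$). Functional extension: a functional extension of $X$ is a proper superset ${}^{*}X\supsetneq X$ together with, for each function $f:X\to X$, a distinguished extension ${}^{*}f:{}^{*}X\to{}^{*}X$ of $f$ (so ${}^{*}f(x)=f(x)$ for $x\in X$), such that: (comp) ${}^{*}(g\circ f)={}^{*}g\circ{}^{*}f$ for all $f,g:X\to X$; (equ) ${}^{*}(\chi_{fg})=\chi_{{}^{*}f\,{}^{*}g}$ for all $f,g:X\to X$, where for two functions $\phi,\psi$ with common domain, $\chi_{\phi\psi}(z)=1$ if $\phi(z)=\psi(z)$ and $\chi_{\phi\psi}(z)=0$ otherwise; (dir) for all $\xi,\eta\in{}^{*}X$ there exist $p_1,p_2:X\to X$ and $\zeta\in{}^{*}X$ such that $\xi={}^{*}p_1(\zeta)$ and $\eta={}^{*}p_2(\zeta)$. Extension of subsets: for $A\subseteq X$ with characteristic function $\chi_A:X\to X$, the function ${}^{*}\chi_A$ takes only the values $0,1$, and ${}^{*}A=\{\xi\in{}^{*}X\mid {}^{*}\chi_A(\xi)=1\}$. The map $A\mapsto{}^{*}A$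 is a Boolean isomorphism from $\mathcal{P}(X)$ onto a field of subsets of ${}^{*}X$. $S$-topology: the topology on ${}^{*}X$ having $\{{}^{*}A\mid A\subseteq X\}$ as an open basis. Ind: different elements of ${}^{*}X$ are separated by the extension of some property of $X$, i.e. for all $\xi\neq\eta$ in ${}^{*}X$ there exists $A\subseteq X$ with $\xi\in{}^{*}A$ and $\eta\notin{}^{*}A$. Poss: for every family $\mathcal{F}$ of subsets of $X$ with the finite intersection property, $\bigcap_{A\in\mathcal{F}}{}^{*}A\neq\emptyset$. Quasi-compact means that every open cover has a finite subcover; compact means quasi-compact and Hausdorff. *)

(* Defs.v *)
From HB Require Import structures.
From mathcomp Require Import all_boot finmap.
From mathcomp Require Import boolp classical_sets filter topology.

Set Implicit Arguments.
Unset Strict Implicit.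
Unset Printing Implicit Defensive.

Local Open Scope classical_set_scope.

Record bipointedSet := BipointedSet {
  bsort :> Type;
  pt0 : bsort;
  pt1 : bsort;
  pt0_neq_pt1 : pt0 <> pt1
}.

Arguments pt0 {_}.
Arguments pt1 {_}.

(* The two values [a] (for false) and [b] (for true) are parameters, because
   chi_{f g} is needed both with values 0, 1 in X and with their images in the
   extension. *)
Definition chi_eq (S T Y : Type) (a b : Y) (f g : S -> T) : S -> Y :=
  fun z => if `[< f z = g z >] then b else a.

Definition chi_set (X : bipointedSet) (A : set X) : X -> X :=
  fun x => if `[< A x >] then pt1 else pt0.

(* The inclusion of X in its extension is an injection [emb]; properness is
   the failure of surjectivity. *)
Record functional_extension (X : bipointedSet) := FunctionalExtension {
  ext_sort :> Type;
  emb : X -> ext_sort;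
  star : (X -> X) -> (ext_sort -> ext_sort);
  emb_inj : injective emb;
  emb_proper : exists xi, forall x, emb x <> xi;
  star_emb : forall f x, star f (emb x) = emb (f x);
  star_comp : forall f g : X -> X, star (g \o f) = star g \o star f;
  star_equ : forall f g : X -> X,
    star (chi_eq pt0 pt1 f g)
    = chi_eq (emb pt0) (emb pt1) (star f) (star g);
  star_dir : forall xi eta : ext_sort,
    exists (p1 p2 : X -> X) (zeta : ext_sort),
      xi = star p1 zeta /\ eta = star p2 zeta
}.

Arguments emb {X E} : rename.
Arguments star {X} E f : rename.

Definition star_set (X : bipointedSet) (E : functional_extension X)
  (A : set X) : set E := [set xi | star E (chi_set A) xi = emb pt1].

Arguments star_set {X} E A.

Definition Ind (X : bipointedSet) (E : functional_extension X) : Prop :=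
  forall xi eta : E, xi <> eta ->
    exists A : set X, star_set E A xi /\ ~ star_set E A eta.

Definition Poss (X : bipointedSet) (E : functional_extension X) : Prop :=
  forall F : set (set X), finI F id -> \bigcap_(A in F) star_set E A !=set0.

Section StarSetTheory.
Variables (X : bipointedSet) (E : functional_extension X).
Implicit Types (A B : set X) (f g : X -> X) (xi : E).

Let emb01 : (emb pt0 : E) <> emb pt1.
Proof. by move=> /emb_inj; exact: pt0_neq_pt1. Qed.

Lemma star_cst1 xi : star E (fun=> pt1) xi = emb pt1.
Proof.
have -> : (fun=> pt1) = chi_eq pt0 pt1 (@id X) id :> (X -> X).
  by apply/funext => x; rewrite /chi_eq asboolT.
by rewrite star_equ /chi_eq asboolT.
Qed.

Lemma star_cst0 xi : star E (fun=> pt0) xi = emb pt0.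
Proof.
have [p1 [p2 [zeta [-> e2]]]] := star_dir xi (emb pt0).
have comp0 p (z : E) : star E (fun=> pt0) (star E p z) = star E (fun=> pt0) z.
  by rewrite -[LHS]/((star E (fun=> pt0) \o star E p) z) -star_comp.
by rewrite comp0 -(comp0 p2) -e2 star_emb.
Qed.

Lemma star_set_eq f g :
  star_set E [set x | f x = g x] = [set xi | star E f xi = star E g xi].
Proof.
rewrite /star_set -[chi_set _]/(chi_eq pt0 pt1 f g) star_equ /chi_eq.
apply/seteqP; split => xi /=; last by move=> e; rewrite asboolT.
by case: asboolP => // _ /emb01.
Qed.

Lemma star_set_preimage f A xi :
  star_set E (f @^-1` A) xi = star_set E A (star E f xi).
Proof.
rewrite /star_set /= -[chi_set (f @^-1` A)]/(chi_set A \o f).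
by rewrite star_comp.
Qed.

Lemma star_setT : star_set E setT = setT.
Proof.
have -> : setT = [set x : X | id x = id x] by apply/seteqP.
by rewrite star_set_eq; apply/seteqP.
Qed.

Lemma star_set0 : star_set E set0 = set0.
Proof.
have -> : set0 = [set x : X | pt0 = pt1 :> X].
  by apply/seteqP; split => // x /= /pt0_neq_pt1.
rewrite (star_set_eq (fun=> pt0) (fun=> pt1)).
by apply/seteqP; split => // xi /=; rewrite star_cst0 star_cst1 => /emb01.
Qed.

(* a retraction onto A when [A a] *)
Let retr A a : X -> X := fun x => if `[< A x >] then x else a.

Let retr_fix A a : A a -> A = [set x | retr A a x = id x].
Proof.
move=> Aa; apply/seteqP; split => x /=; rewrite /retr; case: asboolP => //.
by move=> _ <-.
Qed.

Let star_retr A a : A a ->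
  star_set E A = [set xi | star E (retr A a) xi = star E id xi].
Proof. by move=> Aa; rewrite {1}(retr_fix Aa) star_set_eq. Qed.

Let star_set_id A xi : star_set E A (star E id xi) = star_set E A xi.
Proof. by rewrite -star_set_preimage. Qed.

Lemma star_setS A B : A `<=` B -> star_set E A `<=` star_set E B.
Proof.
move=> AB xi; have [[a Aa]|/nonemptyPn ->] := pselect (A !=set0); last first.
  by rewrite star_set0.
rewrite (star_retr Aa) /= => e.
rewrite -star_set_id -e -star_set_preimage.
have -> : retr A a @^-1` B = setT; last by rewrite star_setT.
apply/seteqP; split => // x _; rewrite /= /retr.
by case: asboolP => [|_]; exact: AB.
Qed.

Lemma star_setI A B : star_set E (A `&` B) = star_set E A `&` star_set E B.
Proof.
apply/seteqP; split => xi.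
  by move=> h; split; apply: star_setS h => x [].
have [[c [Ac Bc]]|/nonemptyPn AB0] := pselect (A `&` B !=set0).
  move=> [xiA xiB]; move: (xiA); rewrite (star_retr Ac) /= => eA.
  have Bfix : star E (retr B c \o retr A c) xi = star E id xi.
    rewrite star_comp /= eA; move: xiB; rewrite (star_retr Bc) /= => eB.
    by rewrite -[LHS]/((star E (retr B c) \o star E id) xi) -star_comp.
  have : star_set E [set x | (retr B c \o retr A c) x = id x] xi.
    by rewrite star_set_eq.
  apply: star_setS => x /=; rewrite /retr.
  case: (asboolP (A x)) => [Ax|nAx]; case: asboolP => //.
  - by move=> _ ex; rewrite -ex; split => //; rewrite ex.
  - by move=> _ ex; case: nAx; rewrite -ex.
move=> [xiA xiB].
have : star_set E [set x | chi_set A x = (fun=> pt0) x] xi.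
  apply: star_setS xiB => x Bx; rewrite /= /chi_set asboolF // => Ax.
  by have : (A `&` B) x by []; rewrite AB0.
by rewrite star_set_eq /= star_cst0 xiA => /esym/emb01.
Qed.

End StarSetTheory.

HB.instance Definition _ (X : bipointedSet) (E : functional_extension X) :=
  gen_eqMixin (ext_sort E).
HB.instance Definition _ (X : bipointedSet) (E : functional_extension X) :=
  gen_choiceMixin (ext_sort E).

Section STopology.
Variables (X : bipointedSet) (E : functional_extension X).

Let star_cover : \bigcup_(A in [set: set X]) star_set E A = setT.
Proof.
by apply/seteqP; split => // xi _; exists setT; rewrite ?star_setT.
Qed.

Let star_join (A B : set X) (xi : E) : [set: set X] A -> [set: set X] B ->
  star_set E A xi -> star_set E B xi ->
  exists C, [/\ [set: set X] C, star_set E C xi &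
                star_set E C `<=` star_set E A `&` star_set E B].
Proof.
by move=> _ _ xiA xiB; exists (A `&` B); rewrite star_setI; split.
Qed.

(* the S-topology: the sets *A, for A a subset of X, form an open base *)
HB.instance Definition _ :=
  isBaseTopological.Build (ext_sort E) star_cover star_join.

End STopology.

Lemma S_openE (X : bipointedSet) (E : functional_extension X) (O : set E) :
  open O <-> exists D : set (set X), O = \bigcup_(A in D) star_set E A.
Proof.
split=> [[D _ <-]|[D ->]]; first by exists D.
by exists D.
Qed.

Definition quasi_compact_space (T : topologicalType) : Prop :=
  cover_compact [set: T].

Definition compact_space (T : topologicalType) : Prop :=
  quasi_compact_space T /\ hausdorff_space T.

(* Main.v *)
Require Import Defs.
From mathcomp Require Import all_boot finmap boolp classical_sets filter topology.

(** The sets *A are clopen because star commutes with complements, so Ind is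
    separation of points by a clopen set and its complement.  Dually, a basic
    open cover {*A} has a finite subcover exactly when the corresponding family
    {~A} of subsets of X lacks the finite intersection property, since star
    commutes with finite intersections and *A is empty only if A is. *)

Local Open Scope classical_set_scope.

Section StarSetBoolean.
Context {X : bipointedSet} {E : functional_extension X}.
Implicit Types A : set X.

Lemma star_set_emb A (x : X) : star_set E A (emb x) <-> A x.
Proof.
rewrite /star_set /= star_emb /chi_set; case: asboolP => // nA.
by split=> // /emb_inj/pt0_neq_pt1.
Qed.

(* chi_A is the equality indicator of itself and the constant 1, hence
   its star takes only the two values 0 and 1. *)
Lemma star_chi_set_pt0 A (xi : E) :
  ~ star_set E A xi -> star E (chi_set A) xi = emb pt0.
Proof.
have chiE : chi_set A = chi_eq pt0 pt1 (chi_set A) (fun=> pt1).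
  apply/funext => x; rewrite /chi_eq /chi_set.
  case: (asboolP (A x)) => _; first by rewrite asboolT.
  by rewrite asboolF //; exact: pt0_neq_pt1.
by rewrite /star_set /= chiE star_equ /chi_eq; case: asboolP.
Qed.

Lemma star_setC A : star_set E (~` A) = ~` star_set E A.
Proof.
apply/seteqP; split=> xi /= xiA.
  move=> xiA'; have : star_set E (A `&` ~` A) xi by rewrite star_setI.
  by rewrite setICr star_set0.
(* As the equalizer of [chi_set A] and the constant 0, the complement extends to the locus where the
   star of [chi_set A] is 0. *)
have -> : ~` A = [set x | chi_set A x = (fun=> pt0) x].
  apply/seteqP; split=> x /=; rewrite /chi_set; case: asboolP => //.
  by move=> _ /esym/pt0_neq_pt1.
by rewrite star_set_eq /= star_cst0 star_chi_set_pt0.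
Qed.

Lemma star_set_bigcap_seq (s : seq (set X)) :
  star_set E (\bigcap_(A in [set` s]) A) = \bigcap_(A in [set` s]) star_set E A.
Proof.
by rewrite !bigcap_seq (big_morph _ (@star_setI X E) (@star_setT X E)).
Qed.

Lemma open_star_set A : open (star_set E A).
Proof. by apply/S_openE; exists [set A]; rewrite bigcup_set1. Qed.

Lemma open_star_set_sub (O : set E) (xi : E) : open O -> O xi ->
  exists2 A, star_set E A xi & star_set E A `<=` O.
Proof.
move=> /S_openE[D ->] [A DA xiA]; exists A => // eta etaA.
by exists A.
Qed.

Lemma Ind_hausdorff : Ind E <-> hausdorff_space E.
Proof.
rewrite open_hausdorff; split=> [ind xi eta /eqP/ind[A [xiA etaA]]|sep xi eta].
  exists (star_set E A, star_set E (~` A)) => /=.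
    by split; apply/mem_set => //; rewrite star_setC.
  split; [exact: open_star_set|exact: open_star_set|].
  by rewrite -star_setI setICr star_set0.
move=> /eqP/sep[[U V] /= [/set_mem Uxi /set_mem Veta] [oU _ /eqP UV0]].
(* A basic neighbourhood of [xi] inside [U] misses [V], hence [eta]. *)
have [A xiA AU] := open_star_set_sub _ _ oU Uxi; exists A; split=> // /AU Ueta.
by have : (U `&` V) eta by []; rewrite UV0.
Qed.

Lemma Poss_quasi_compact : Poss E -> quasi_compact_space E.
Proof.
move=> poss I D f fo fcov.
(* Complements of the basic sets that refine the cover: a point of [star_set E A] for every [A] in
   [F] would be uncovered. *)
pose F : set (set X) := [set A | exists2 i, D i & star_set E (~` A) `<=` f i].
have notFIP : ~ finI F id.
  move=> /poss[xi xiF]; have [i Di fxi] := fcov xi Logic.I.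
  have [A xiA Af] := open_star_set_sub _ _ (fo i Di) fxi.
  have : star_set E (~` A) xi by apply: xiF; exists i => //; rewrite setCK.
  by rewrite star_setC.
have [G GF capG0] : exists2 G : {fset set X},
    {subset G <= F} & \bigcap_(A in [set` G]) A = set0.
  apply: contrapT => noG; apply: notFIP => G GF.
  by apply: contrapT => /nonemptyPn G0; apply: noG; exists G.
(* A default index, so that [h] is total; it exists because the cover reaches [emb pt0]. *)
have [i0 Di0] : exists i, D i by have [i Di _] := fcov (emb pt0) Logic.I; exists i.
have /choice[h hP] A : exists i, D i /\ (A \in G -> star_set E (~` A) `<=` f i).
  have [/GF/set_mem[i Di fi]|nGA] := boolP (A \in G); first by exists i.
  by exists i0.
exists [fset h A | A in G]%fset.
  by move=> _ /imfsetP[A _ ->]; apply/mem_set; case: (hP A).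
move=> xi _; apply: contrapT => nxi.
(* A point missed by the finite subfamily lies in each [star_set E A] with [A] in [G], hence in the
   star of their empty intersection. *)
suff : star_set E (\bigcap_(A in [set` G]) A) xi by rewrite capG0 star_set0.
rewrite star_set_bigcap_seq => A /= GA; apply: contrapT => nA; apply: nxi.
exists (h A); first by apply/imfsetP; exists A.
by apply: (hP A).2 => //; rewrite star_setC.
Qed.

Lemma quasi_compact_Poss : quasi_compact_space E -> Poss E.
Proof.
move=> qc F Ffip; apply: contrapT => /nonemptyPn capF0.
have [|xi _|G GF Gcov] := qc _ F (fun A => star_set E (~` A)).
- by move=> A _; exact: open_star_set.
- apply: contrapT => nxi.
  suff : (\bigcap_(A in F) star_set E A) xi by rewrite capF0.
  move=> A FA; apply: contrapT => nA; apply: nxi.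
  by exists A => //; rewrite star_setC.
(* It suffices to test the finite subcover at one embedded point of [X], a common element of the
   sets in [G]. *)
have [x xG] := Ffip G GF; have [A GA] := Gcov (emb x) Logic.I.
by move=> /star_set_emb; apply; exact: xG.
Qed.

End StarSetBoolean.

Theorem corollary2p2 (X : bipointedSet) (E : functional_extension X) :
  [/\ Ind E <-> hausdorff_space E,
      Poss E <-> quasi_compact_space E
    & (Ind E /\ Poss E) <-> compact_space E].
Proof.
have PossE : Poss E <-> quasi_compact_space E.
  by split; [exact: Poss_quasi_compact|exact: quasi_compact_Poss].
split; [exact: Ind_hausdorff|exact: PossE|].
by rewrite /compact_space Ind_hausdorff PossE; split=> -[].
Qed.
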